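(* Let $G$ be a finite group, let $*$ be a nonidentical involutory antiautomorphism of $G$ with $gg^*\in Z(G)$ for every $g\in G$, and let $g_0\in Z(G)$ with $g_0^*=g_0$. Let $\beta\in\{xy,\,x^*y,\,yx,\,yx^*\}$, $\gamma\in\{xy,\,yx\}$ and $\delta\in\{g_0xy,\,g_0xy^*,\,g_0x^*y,\,g_0x^*y^*,\,g_0yx,\,g_0yx^*,\,g_0y^*x,\,g_0y^*x^*\}$. Then the loop $L=Q(G,*,g_0,\beta,\gamma,\delta)$ is a C-loop if and only if at least one of the following holds: (a) $L$ is extra; (b) $G/Z(G)$ is an elementary abelian $2$-group and $(\beta,\gamma,\delta)$ is among $(yx,yx,g_0yx)$, $(yx^*,xy,g_0x^*y)$.
   Context: $Z(G)$ is the center of $G$. An involutory antiautomorphism $*$ of $G$ satisfies $(g^* )^*=g$ and $(gh)^*=h^*g^*$; nonidentical means $g^*\neq g$ for some $g\in G$. A word such as $yx^*$ or $g_0y^*x$ denotes the function $G\times G\to G$ sending $(x,y)$ to the value of the word. Words are regarded as functions: two words are identified when they define the same function on $G\times G$ (for instance $xy$ and $yx$ when $G$ is commutative), and equality of triples $(\beta,\gamma,\delta)$ means equality of the three functions. Let $Gu=\{gu : g\in G\}$ be a disjoint copy of $G$. The loop $Q(G,*,g_0,\beta,\gamma,\delta)$ is the set $G\cup Gu$ with the multiplication, for $x,y\in G$, $$x\circ y=xy,\quad x\circ yu=\beta(x,y)u,\quad xu\circ y=\gamma(x,y)u,\quad xu\circ yu=\delta(x,y).$$ It is a loop with neutral element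 $1\in G$. The trivial group counts as an elementary abelian $2$-group. A loop is a C-loop if it satisfies $((xy)y)z=x(y(yz))$, and extra if it satisfies $x(y(zx))=((xy)z)x$. *)

(* Defs.v *)
From mathcomp Require Import all_boot all_fingroup all_solvable.
Set Implicit Arguments.
Unset Strict Implicit.
Unset Printing Implicit Defensive.
Local Open Scope group_scope.

Section Loops.
Variables (T : Type) (op : T -> T -> T) (e : T).
Local Notation "x ** y" := (op x y) (at level 40, left associativity).

Definition is_loop : Prop :=
  [/\ left_id e op, right_id e op,
      forall a b, exists! x, a ** x = b &
      forall a b, exists! y, y ** a = b].

Definition is_C_loop : Prop :=
  is_loop /\ forall x y z, ((x ** y) ** y) ** z = x ** (y ** (y ** z)).

Definition is_extra_loop : Prop :=
  is_loop /\ forall x y z, x ** (y ** (z ** x)) = ((x ** y) ** z) ** x.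

End Loops.

Definition involutory_antiautomorphism (G : finGroupType) (star : G -> G) :=
  (forall g, star (star g) = g) /\
  (forall g h, star (g * h) = star h * star g).

(* Words are compared as functions: Leibniz equality of finfuns is extensional
   equality on G x G. *)
Definition word (G : finGroupType) (w : G -> G -> G) : {ffun G * G -> G} :=
  [ffun p => w p.1 p.2].

(* The underlying set G + Gu of Q(G, *, g0, beta, gamma, delta): [inl x] stands
   for x and [inr x] for xu. The parameters * and g0 enter the multiplication
   only through beta, gamma and delta. *)
Definition Qmul (G : finGroupType) (beta gamma delta : {ffun G * G -> G})
    (a b : G + G) : G + G :=
  match a, b with
  | inl x, inl y => inl (x * y)
  | inl x, inr y => inr (beta (x, y))
  | inr x, inl y => inr (gamma (x, y))
  | inr x, inr y => inl (delta (x, y))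
  end.

Definition Qone (G : finGroupType) : G + G := inl 1.

(* Main.v *)
(* Write X for star x. Every extra loop is a C-loop. Conversely, the alternative
   laws contained in the C identity discard all triples except those in which
   beta and delta are built from the same two letters, x, y or X, y, and
   outside four triples they force G to be commutative. A commutative G turns
   every surviving triple into one of the two triples of (b). In the
   noncommutative case, (xy, xy, g0xy) gives a group, while (yx, yx, g0yx),
   (yX, xy, g0Xy) and (Xy, yx, g0yX) force all squares of G to be central,
   which makes the last one extra. *)

Require Import Defs.
From mathcomp Require Import all_boot all_fingroup all_solvable.
Local Open Scope group_scope.

(** * Extra loops are C-loops *)

Section ExtraLoops.
Variables (T : finType) (op : T -> T -> T) (e : T).
Local Notation "x ** y" := (op x y) (at level 40, left associativity).

Lemma loop_mulI : is_loop op e -> right_injective op.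
Proof.
move=> [_ _ ex _] a x y axy; have [c [_ uc]] := ex a (a ** y).
by rewrite -(uc x axy) -(uc y erefl).
Qed.

Lemma loop_mIop : is_loop op e -> left_injective op.
Proof.
move=> [_ _ _ ex] a x y axy; have [c [_ uc]] := ex a (y ** a).
by rewrite -(uc x axy) -(uc y erefl).
Qed.

(** On a finite set an injective translation is bijective, and its inverse solves the equation
    uniquely. *)
Lemma inj_is_loop :
  left_id e op -> right_id e op -> right_injective op -> left_injective op ->
  is_loop op e.
Proof.
move=> op1l op1r injr injl; split=> // a b.
- have [f fK Kf] := injF_bij (injr a).
  by exists (f b); split=> [|y <-]; rewrite ?Kf ?fK.
- have [f fK Kf] := injF_bij (injl a).
  by exists (f b); split=> [|y <-]; rewrite ?Kf ?fK.
Qed.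

Lemma extra_loop_C : is_extra_loop op e -> is_C_loop op e.
Proof.
move=> [loopT extra]; split=> //.
have [op1l op1r exr exl] := loopT.
have injr := @loop_mulI loopT; have injl := @loop_mIop loopT.
(* The extra identity yields the inverse property: left inverses are two-sided, cancel on both
   sides, and inversion reverses products. *)
have /fin_all_exists[i iV] x : exists y, y ** x = e.
  by have [y [yx _]] := exl x e; exists y.
have VK x a : (a ** i x) ** x = a.
  have [y [<- _]] := exr x a.
  by have := extra x y (i x); rewrite iV op1r.
have KV x a : (a ** x) ** i x = a by apply: (injl x); rewrite VK.
have Vi x : x ** i x = e by have := KV x e; rewrite op1l.
have lVK x b : x ** (i x ** b) = b.
  have [z [<- _]] := exl x b.
  by rewrite extra Vi op1l.
have lKV x b : i x ** (x ** b) = b by apply: (injr x); rewrite lVK.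
have ii x : i (i x) = x by apply: (injl (i x)); rewrite iV Vi.
have iM a b : i (a ** b) = i b ** i a.
  by rewrite -[i b in RHS](lKV (a ** b)) !KV.
have flex p z : p ** (z ** p) = (p ** z) ** p.
  by have := extra p e z; rewrite op1l op1r.
(* With L and R the translations by p, the next three identities say that
   (L, R^-1, L R^-1), (L R^-1, L, L) and (R^-1, L R^-1, R^-1) are autotopisms;
   inverting the first and composing it with the other two gives
   (R^-2, L^2, 1), which is the C identity. *)
have A p y w : (p ** y) ** (w ** i p) = (p ** (y ** w)) ** i p.
  by apply: (injl p); rewrite -extra !VK.
have B p y z : ((p ** y) ** i p) ** (p ** z) = p ** (y ** z).
  (* With [J] the inversion, an autotopism [(U, V, W)] yields [(W, J V J, U)] and [(J U J, W, V)].
     These transforms of [A] are [B] and [D], since [J] exchanges [L] with [R^-1]. *)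
  have := A p (y ** z) (i z); rewrite KV => <-.
  by rewrite -iM VK.
have D p y z : (y ** i p) ** ((p ** z) ** i p) = (y ** z) ** i p.
  have := A p (i y) (y ** z); rewrite lKV => <-.
  by rewrite -{1}[y]ii -iM lKV.
move=> x p z.
(* The left factor [(x ** p) ** p] is chosen so that the factors [R^-1] put on it by [D] and [B]
   both cancel. *)
have := congr1 (op p) (D p ((x ** p) ** p) z); rewrite -B !KV.
have -> : (p ** (x ** p)) ** i p = p ** x by rewrite flex KV.
have -> : p ** ((p ** z) ** i p) = (p ** (p ** z)) ** i p.
  by apply: (injl p); rewrite VK -flex VK.
rewrite A => /(congr1 (op^~ p)); rewrite VK -flex VK.
by move/injr.
Qed.

End ExtraLoops.

(** * Criteria for loops and for central squares *)

Lemma Qmul_is_loop (G : finGroupType) (b c d : {ffun G * G -> G}) :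
  (forall y, b (1, y) = y) -> (forall x, c (x, 1) = x) ->
  (forall x, injective (fun y => b (x, y))) ->
  (forall y, injective (fun x => b (x, y))) ->
  (forall x, injective (fun y => c (x, y))) ->
  (forall y, injective (fun x => c (x, y))) ->
  (forall x, injective (fun y => d (x, y))) ->
  (forall y, injective (fun x => d (x, y))) ->
  is_loop (Qmul b c d) (Qone G).
Proof.
move=> b1 c1 bI Ib cI Ic dI Id; apply: inj_is_loop.
- by case=> x; rewrite /= ?mul1g ?b1.
- by case=> x; rewrite /= ?mulg1 ?c1.
- case=> x [y|y] [z|z] //= [].
  + by move/mulgI->.
  + by move/bI->.
  + by move/cI->.
  + by move/dI->.
- case=> x [y|y] [z|z] //= [].
  + by move/mulIg->.
  + by move/Ic->.
  + by move/Ib->.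
  + by move/Id->.
Qed.

Lemma wordE (G : finGroupType) (w : G -> G -> G) x y : word w (x, y) = w x y.
Proof. by rewrite ffunE. Qed.

Lemma eq_word (G : finGroupType) (w1 w2 : G -> G -> G) :
  w1 =2 w2 -> word w1 = word w2.
Proof. by move=> eqw; apply/ffunP=> -[x y]; rewrite !wordE. Qed.

(** A group of exponent dividing 2 is abelian, so only the squares of the quotient matter. *)
Lemma abelem2_quotient_center (G : finGroupType) :
  2.-abelem ([set: G] / 'Z([set: G])) <-> forall x y : G, x * x * y = y * (x * x).
Proof.
have nZ (x : G) : x \in 'N('Z([set: G])).
  by rewrite (subsetP (normal_norm (center_normal _))) ?inE.
have sqZ (x : G) : (coset 'Z([set: G]) x ^+ 2 == 1) = (x * x \in 'Z([set: G])).
  by rewrite -morphX ?nZ //; apply/eqP/idP => [/coset_idr->|/coset_id].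
split=> [/(abelemP _)[//|_ sq1] x y | sqC].
  have /centerP[_ /(_ y)->//] : x * x \in 'Z([set: G]).
  by rewrite -sqZ sq1 // mem_quotient.
apply/exponent2_abelem/exponentP=> _ /morphimP[x _ _ ->].
by apply/eqP; rewrite sqZ; apply/centerP; split=> // y _; apply: sqC.
Qed.

(** * Calculus with [star] and central elements *)

Section CLoops.
Variables (G : finGroupType) (star : G -> G) (g0 : G).
Hypothesis starK : involutive star.
Hypothesis starM : forall x y, star (x * y) = star y * star x.
Hypothesis normC : forall x y, x * star x * y = y * (x * star x).
Hypothesis g0C : forall x, g0 * x = x * g0.
Hypothesis star_g0 : star g0 = g0.

Lemma star_inj : injective star.
Proof. exact: can_inj starK. Qed.

Lemma star1 : star 1 = 1.
Proof. by apply: (mulgI (star 1)); rewrite -starM !mulg1. Qed.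

Lemma star_comm x : star x * x = x * star x.
Proof. by apply: (mulgI x); rewrite mulgA normC. Qed.

(** The variants ending in [A] carry a trailing factor, so that they rewrite inside products nested
    to the right. *)
Let g0CA (x y : G) : x * (g0 * y) = g0 * (x * y).
Proof. by rewrite !mulgA g0C. Qed.

Let wordsE := (wordE, starM, starK, star_g0, star1, @mul1g G, @mulg1 G).

Let star_commA x y : star x * (x * y) = x * (star x * y).
Proof. by rewrite !mulgA star_comm. Qed.

Let normCA x y z : y * (x * (star x * z)) = x * (star x * (y * z)).
Proof. by rewrite !(mulgA x) (mulgA y) -normC mulgA. Qed.

(** A word with one letter fixed is a composition of translations of [G] and possibly [star]; these
    injective maps are peeled off one by one. *)
Ltac latin := move=> x y z /=; rewrite !wordsE;
  do ?[move/mulgI | move/mulIg | move/star_inj].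

(** This loop is the group obtained from [G] by adjoining a central [u] with square [g0], and
    associativity implies the extra identity. *)
Lemma xy_xy_xy_extra :
  is_loop (Qmul (word (fun x y : G => x * y)) (word (fun x y : G => x * y))
                (word (fun x y : G => g0 * x * y))) (Qone G) ->
  is_extra_loop (Qmul (word (fun x y : G => x * y)) (word (fun x y : G => x * y))
                      (word (fun x y : G => g0 * x * y))) (Qone G).
Proof.
split=> // -[x|x] [y|y] [z|z]; by rewrite /= ?wordsE -?mulgA ?g0CA.
Qed.

(** * Triples over a group with central squares *)

Section Square.
Hypothesis sqC : forall x y : G, x * x * y = y * (x * x).

Lemma sqCA (x y z : G) : y * (x * (x * z)) = x * (x * (y * z)).
Proof. by rewrite !(mulgA x x) (mulgA y) -sqC mulgA. Qed.

(** As [x * star x] and [x * x] are central, [star x] is [x] times a central element, so the two may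
    change places around [y]. *)
Lemma star_swap x y : star x * (y * x) = x * (y * star x).
Proof. by apply: (mulgI x); rewrite mulgA normC -mulgA sqCA. Qed.

Lemma star_swapA x y z : star x * (y * (x * z)) = x * (y * (star x * z)).
Proof. by rewrite (mulgA y x) (mulgA (star x)) star_swap -!mulgA. Qed.

(** Apart from the central [g0], the two sides of each case differ at most in the place of
    [y * y]. *)
Lemma yx_yx_yx_C :
  is_C_loop (Qmul (word (fun x y : G => y * x)) (word (fun x y : G => y * x))
                  (word (fun x y : G => g0 * y * x))) (Qone G).
Proof.
split.
  apply: Qmul_is_loop => [y|x||||||]; rewrite ?wordsE //; by latin.
move=> [x|x] [y|y] [z|z]; rewrite /= ?wordsE -?mulgA ?g0CA //.
- by rewrite -sqC -mulgA.
- by rewrite -[z * (y * y)]sqC -mulgA (sqCA y x).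
- by rewrite (sqCA y z).
Qed.

(** Central squares serve only the case [xu], [y], [zu]; elsewhere it suffices to move [g0] and the
    central [y * star y]. *)
Lemma yX_xy_Xy_C :
  is_C_loop (Qmul (word (fun x y : G => y * star x)) (word (fun x y : G => x * y))
                  (word (fun x y : G => g0 * star x * y))) (Qone G).
Proof.
split.
  apply: Qmul_is_loop => [y|x||||||]; rewrite ?wordsE //; by latin.
move=> [x|x] [y|y] [z|z]; rewrite /= ?wordsE -?mulgA ?g0CA //.
- by rewrite -[star x * g0]g0C !g0CA star_commA normCA.
- by rewrite -[z * _]sqC -mulgA (sqCA _ (star x)).
- by rewrite star_commA (normCA y x).
Qed.

Lemma Xy_yx_yX_extra :
  is_loop (Qmul (word (fun x y : G => star x * y)) (word (fun x y : G => y * x))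
                  (word (fun x y : G => g0 * y * star x))) (Qone G) ->
  is_extra_loop (Qmul (word (fun x y : G => star x * y)) (word (fun x y : G => y * x))
                  (word (fun x y : G => g0 * y * star x))) (Qone G).
Proof.
split=> // -[x|x] [y|y] [z|z]; rewrite /= ?wordsE -?mulgA ?g0CA //.
- by rewrite star_swapA.
- by rewrite star_swapA.
- by rewrite -[star y * _]sqC -mulgA (sqCA _ z).
- by rewrite -[star z * _]normC -mulgA normCA.
Qed.

End Square.

(** * Elimination of the other triples *)

Lemma C_loop_cases (b c d : {ffun G * G -> G}) :
  ~ star =1 id ->
  b \in [:: word (fun x y : G => x * y);
            word (fun x y : G => star x * y);
            word (fun x y : G => y * x);
            word (fun x y : G => y * star x)] ->
  c \in [:: word (fun x y : G => x * y);
            word (fun x y : G => y * x)] ->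
  d \in [:: word (fun x y : G => g0 * x * y);
            word (fun x y : G => g0 * x * star y);
            word (fun x y : G => g0 * star x * y);
            word (fun x y : G => g0 * star x * star y);
            word (fun x y : G => g0 * y * x);
            word (fun x y : G => g0 * y * star x);
            word (fun x y : G => g0 * star y * x);
            word (fun x y : G => g0 * star y * star x)] ->
  is_C_loop (Qmul b c d) (Qone G) ->
  is_extra_loop (Qmul b c d) (Qone G) \/
  (forall x y : G, x * x * y = y * (x * x)) /\
  (b, c, d) \in
      [:: (word (fun x y : G => y * x),
           word (fun x y : G => y * x),
           word (fun x y : G => g0 * y * x));
          (word (fun x y : G => y * star x),
           word (fun x y : G => x * y),
           word (fun x y : G => g0 * star x * y))].
Proof.
move=> star_id b_in c_in d_in [loopQ CQ]; set concl := (_ \/ _).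
have bbb x y z : b (x * y * y, z) = b (x, b (y, b (y, z))).
  by have [] := CQ (inl x) (inl y) (inr z).
have dbb x y z : d (c (c (x, y), y), z) = d (x, b (y, b (y, z))).
  by have [] := CQ (inr x) (inl y) (inr z).
rewrite !inE in b_in c_in d_in.
have b1 z : b (1, z) = z by case/or4P: b_in => /eqP->; rewrite ?wordsE.
have c1 z : c (1, z) = z by case/orP: c_in => /eqP->; rewrite ?wordsE.
have bg0 z : b (g0, z) = g0 * z.
  by case/or4P: b_in => /eqP->; rewrite ?wordsE ?g0C.
(* Setting [x = 1] gives left alternative laws; [z = 1] below gives a right one. *)
have bdd y z : b (d (y, y), z) = c (y, d (y, z)).
  by have [] := CQ (inl 1) (inr y) (inr z); rewrite /= !b1.
have ddc y z : d (y, y) * z = d (y, c (y, z)).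
  by have [] := CQ (inl 1) (inr y) (inl z); rewrite /= !b1 mul1g.
have ddb x y : d (b (x, y), y) = x * d (y, y).
  have [] := CQ (inl x) (inr y) (inl 1); rewrite mulg1 => ->.
  by rewrite -ddc mulg1.
have d11 : d (1, 1) = g0.
  by case/or4P: d_in => [|||/or4P[|||/orP[]]] /eqP->; rewrite !wordsE.
have d1 z : d (1, z) = g0 * z by have := bdd 1 z; rewrite d11 c1 bg0.
have db1 x : d (b (x, 1), 1) = g0 * x by rewrite ddb d11 g0C.
have c_comm (K : forall x y : G, x * y = y * x) :
    c = word (fun x y : G => x * y) /\ c = word (fun x y : G => y * x).
  by case/orP: c_in => /eqP->; split=> //; apply: eq_word.
(* Over a commutative [G] a surviving triple is determined by whether [x] is starred; [comm_yx] and
   [comm_yX] treat the two possibilities. *)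
have comm_yx (K : forall x y : G, x * y = y * x) :
    (forall x y, b (x, y) = y * x) -> (forall x y, d (x, y) = g0 * y * x) ->
    concl.
  move=> bE dE; right; split=> [x y|]; first by rewrite K.
  have [_ ->] := c_comm K.
  have -> : b = word (fun x y : G => y * x) by apply/ffunP=> -[x y]; rewrite wordE.
  have -> : d = word (fun x y : G => g0 * y * x)
    by apply/ffunP=> -[x y]; rewrite wordE.
  by rewrite !inE eqxx.
have comm_yX (K : forall x y : G, x * y = y * x) :
    (forall x y, b (x, y) = y * star x) ->
    (forall x y, d (x, y) = g0 * star x * y) -> concl.
  move=> bE dE; right; split=> [x y|]; first by rewrite K.
  have [-> _] := c_comm K.
  have -> : b = word (fun x y : G => y * star x)
    by apply/ffunP=> -[x y]; rewrite wordE.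
  have -> : d = word (fun x y : G => g0 * star x * y)
    by apply/ffunP=> -[x y]; rewrite wordE.
  by rewrite !inE eqxx orbT.
(* Since [star] is onto, an identity in starred letters holds for arbitrary elements. *)
have comm_star : (forall x y : G, star x * y = y * star x) ->
    forall x y : G, x * y = y * x.
  by move=> sC x y; rewrite -[x]starK sC.
have sqC_star : (forall x y, star y * (star y * star x) = star x * (star y * star y)) ->
    forall x y : G, x * x * y = y * (x * x).
  by move=> sC x y; have := sC (star y) (star x); rewrite !starK mulgA.
(* By [d1], a [delta] with [y] starred would make [star] the identity. *)
case/or4P: d_in => [|||/or4P[|||/orP[]]] /eqP dE;
  try by case: star_id => z; have := d1 z; rewrite dE !wordsE => /mulgI.
(* By [db1], [x] is starred in both of [beta] and [delta] or in neither; eight pairs remain. *)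
all: case/or4P: b_in => /eqP bE;
  try by case: star_id => z; have := db1 z;
         rewrite bE dE !wordsE -?mulgA => /mulgI.
- case/orP: c_in => /eqP cE.
    by left; move: loopQ; rewrite bE cE dE; apply: xy_xy_xy_extra.
  have K (x y : G) : x * y = y * x.
    by have := ddc x y; rewrite cE dE !wordE -!mulgA => /mulgI/mulgI.
  by apply: comm_yx => // x y; rewrite ?bE ?dE wordE -?mulgA (K x y).
- have K (x y : G) : x * y = y * x.
    have := ddb y x; rewrite bE dE !wordE -!mulgA g0CA => /mulgI.
    by rewrite !mulgA => /mulIg.
  by apply: comm_yx => // x y; rewrite ?bE ?dE wordE -?mulgA // (K x y).
- have K : forall x y : G, x * y = y * x.
    apply: comm_star => x y.
    have := ddb y x; rewrite bE dE !wordsE -!mulgA g0CA => /mulgI.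
    by rewrite !mulgA => /mulIg.
  by apply: comm_yX => // x y; rewrite ?bE ?dE wordE -?mulgA // (K _ y).
- case/orP: c_in => /eqP cE.
    right; split; last by rewrite bE cE dE !inE eqxx orbT.
    (* At [z = 1] the identity [dbb] only moves [star y * star y] past [star x], which makes squares
       central. *)
    apply: sqC_star => x y.
    by have := dbb x y 1; rewrite bE cE dE !wordsE -!mulgA => /mulgI.
  have K (x y : G) : x * y = y * x.
    by have := ddc x y; rewrite cE dE !wordE -!mulgA => /mulgI/mulgI.
  by apply: comm_yX => // x y; rewrite ?bE ?dE wordE.
- have K (x y : G) : x * y = y * x.
    have := ddb y x; rewrite bE dE !wordE -!mulgA g0CA => /mulgI.
    by rewrite !mulgA => /mulIg.
  by apply: comm_yx => // x y; rewrite ?bE ?dE wordE -?mulgA // (K x y).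
- case/orP: c_in => /eqP cE.
    have K (x y : G) : x * y = y * x.
      by have := ddc x y; rewrite cE dE !wordE -!mulgA => /mulgI/mulgI.
    by apply: comm_yx => // x y; rewrite ?bE ?dE wordE.
  right; split; last by rewrite bE cE dE !inE eqxx.
  move=> x y; have := bbb y x 1; rewrite bE !wordsE => <-.
  by rewrite mulgA.
- case/orP: c_in => /eqP cE.
    have K : forall x y : G, x * y = y * x.
      apply: comm_star => x y.
      by have := ddc x y; rewrite cE dE !wordE -!mulgA => /mulgI/mulgI.
    by apply: comm_yX => // x y; rewrite ?bE ?dE wordE -?mulgA // (K _ y).
  left; move: loopQ; rewrite bE cE dE; apply: Xy_yx_yX_extra.
  apply: sqC_star => x y.
  by have := bbb x y 1; rewrite bE !wordsE.
- have K (x y : G) : x * y = y * x.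
    have := ddb y x; rewrite bE dE !wordsE -!mulgA g0CA => /mulgI.
    by rewrite !mulgA => /mulIg.
  by apply: comm_yX => // x y; rewrite ?bE ?dE wordE -?mulgA // (K _ y).
Qed.

End CLoops.

(** * The equivalence *)

Theorem theorem8p4 (G : finGroupType) (star : G -> G) (g0 : G)
    (beta gamma delta : {ffun G * G -> G}) :
  involutory_antiautomorphism star ->
  (exists g, star g <> g) ->
  (forall g, g * star g \in 'Z([set: G])) ->
  g0 \in 'Z([set: G]) ->
  star g0 = g0 ->
  beta \in [:: word (fun x y : G => x * y);
               word (fun x y : G => star x * y);
               word (fun x y : G => y * x);
               word (fun x y : G => y * star x)] ->
  gamma \in [:: word (fun x y : G => x * y);
                word (fun x y : G => y * x)] ->
  delta \in [:: word (fun x y : G => g0 * x * y);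
                word (fun x y : G => g0 * x * star y);
                word (fun x y : G => g0 * star x * y);
                word (fun x y : G => g0 * star x * star y);
                word (fun x y : G => g0 * y * x);
                word (fun x y : G => g0 * y * star x);
                word (fun x y : G => g0 * star y * x);
                word (fun x y : G => g0 * star y * star x)] ->
  is_C_loop (Qmul beta gamma delta) (Qone G) <->
  (is_extra_loop (Qmul beta gamma delta) (Qone G) \/
   (2.-abelem ([set: G] / 'Z([set: G])) /\
    (beta, gamma, delta) \in
      [:: (word (fun x y : G => y * x),
           word (fun x y : G => y * x),
           word (fun x y : G => g0 * y * x));
          (word (fun x y : G => y * star x),
           word (fun x y : G => x * y),
           word (fun x y : G => g0 * star x * y))])).
Proof.
move=> [starK starM] [g star_g] normZ /centerP[_ g0Z] star_g0 b_in c_in d_in.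
have normC x y : x * star x * y = y * (x * star x).
  by have /centerP[_ /(_ y)->] := normZ x.
have g0C x : g0 * x = x * g0 by rewrite g0Z.
split=> [CQ | [/extra_loop_C//|]].
  have star_id : ~ star =1 id by move/(_ g).
  have [|[sqC ?]] := C_loop_cases _ _ _ starK starM normC g0C
                       star_g0 _ _ _ star_id b_in c_in d_in CQ; first by left.
  by right; split=> //; apply/abelem2_quotient_center.
case=> /abelem2_quotient_center sqC.
rewrite !inE => /orP[] /eqP[-> -> ->]; first exact: yx_yx_yx_C.
exact: yX_xy_Xy_C.
Qed.
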